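(* Let $n\ge 1$ and let $k_1<k_2<\cdots<k_n$ be integers. Then the number of monotone triangles with $n$ rows and bottom row $(k_1,\ldots,k_n)$ is equal to the value at $(x_1,\ldots,x_n)=(k_1,\ldots,k_n)$ of the polynomial $$\left( \prod_{1 \le p < q \le n} \left(\operatorname{id} + E_{x_q} \Delta_{x_p}\right)^{-1} \right) \prod_{1 \le i < j \le n} \frac{x_j - x_i}{j-i}.$$
   Context: A monotone triangle with $n$ rows is a triangular array $(a_{i,j})_{1\le j\le i\le n}$ of integers such that $a_{i,j}\le a_{i-1,j}\le a_{i,j+1}$ and $a_{i,j}<a_{i,j+1}$ whenever the indices are in range; its bottom row is $(a_{n,1},\ldots,a_{n,n})$. For a variable $x$, $E_x$ is the shift operator on polynomials, $E_x\,p(x)=p(x+1)$, and $\Delta_x=E_x-\operatorname{id}$. Products of operators denote composition (all these operators commute). On the polynomial ring $\mathbb{C}[x_1,\ldots,x_n]$ the operator $\operatorname{id}+E_{x_q}\Delta_{x_p}$ is invertible, with inverse $\sum_{l\ge 0}(-1)^l E_{x_q}^l\Delta_{x_p}^l$ (a finite sum on each polynomial). *)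

(* Defs.v *)
From HB Require Import structures.
From mathcomp Require Import all_boot all_order all_algebra.
From mathcomp Require Import mpoly.
Set Implicit Arguments. Unset Strict Implicit. Unset Printing Implicit Defensive.
Import Order.TTheory GRing.Theory Num.Theory.
Local Open Scope ring_scope.

(* Polynomials in x_1..x_n are modelled as {mpoly rat[n]}; variable x_(i+1) is 'X_i, i : 'I_n. *)

Definition shiftE (n : nat) (q : 'I_n) (p : {mpoly rat[n]}) : {mpoly rat[n]} :=
  comp_mpoly [tuple (if i == q then 'X_i + 1 else 'X_i) | i < n] p.

Definition deltaOp (n : nat) (p : 'I_n) (f : {mpoly rat[n]}) : {mpoly rat[n]} :=
  shiftE p f - f.

(* (id + E_{x_q} Delta_{x_p})^{-1} f := sum_{l >= 0} (-1)^l E_{x_q}^l Delta_{x_p}^l f.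
   Delta_{x_p}^l f = 0 as soon as l exceeds the degree of f in x_p, hence as soon as
   l >= msize f; the sum is truncated there (all further terms vanish). *)
Definition invOp (n : nat) (p q : 'I_n) (f : {mpoly rat[n]}) : {mpoly rat[n]} :=
  \sum_(l < (msize f).+1)
     ((-1) ^+ l) *: iter l (shiftE q) (iter l (deltaOp p) f).

Definition pairs_lt (n : nat) : seq ('I_n * 'I_n) :=
  [seq pq <- [seq (p, q) | p <- enum 'I_n, q <- enum 'I_n] | (nat_of_ord pq.1 < nat_of_ord pq.2)%N].

(* Composition of all the (commuting) operators (id + E_{x_q} Delta_{x_p})^{-1}, p < q. *)
Definition allInvOps (n : nat) (f : {mpoly rat[n]}) : {mpoly rat[n]} :=
  foldr (fun pq g => invOp pq.1 pq.2 g) f (pairs_lt n).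

Definition vandermonde_normalized (n : nat) : {mpoly rat[n]} :=
  \prod_(i < n) \prod_(j < n | (i < j)%N) (('X_j - 'X_i) * ((j - i)%N%:R)^-1).

(* Monotone triangles with n rows, 0-based: entry a (i, j) for j <= i < n is
   a_{i+1, j+1}; entries with j > i are fixed to 0 so that each triangle is
   represented by exactly one finite function. *)
Definition is_monotone_triangle (n : nat) (a : {ffun 'I_n * 'I_n -> int}) : Prop :=
  (forall i j : 'I_n, (i < j)%N -> a (i, j) = 0) /\
  (forall (i j i' j' : 'I_n), i = i'.+1 :> nat -> (j <= i')%N -> j' = j.+1 :> nat ->
      a (i, j) <= a (i', j) /\ a (i', j) <= a (i, j')) /\
  (forall (i j j' : 'I_n), (j' <= i)%N -> j' = j.+1 :> nat -> a (i, j) < a (i, j')).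

Definition has_bottom_row (n : nat) (a : {ffun 'I_n * 'I_n -> int}) (k : 'I_n -> int) : Prop :=
  forall (i j : 'I_n), i = n.-1 :> nat -> a (i, j) = k j.

(* Main.v *)
(* Write V_n for the normalized Vandermonde product and M_n for the image of V_n under
   all the operators (id + E_q Delta_p)^{-1}. With b_j(x) = x(x+1)...(x+j-1)/j!, one has
   V_n = det (b_j(x_i))_{0 <= j < n}. Let W_n = det (b_{j+1}(x_i)) and let B_n be its
   image under the inverse operators. Three facts about B_n are needed.
   (1) Taking the backward difference in all variables turns W_n into V_n, hence B_n
       into M_n, as b_{j+1}(x) - b_{j+1}(x-1) = b_j(x).
   (2) Expanding det (b_j(x_i)) along the column j = 0 writes V_{n+1} as an alternating
       sum of copies of W_n omitting one variable x_r. On polynomials free of x_r,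
       id + E_r Delta_p = E_p and id + E_q Delta_r = id, so
         M_{n+1}(k) = sum_r (-1)^r B_n(k_1 - 1, .., k_{r-1} - 1, k_{r+1}, .., k_{n+1}).
   (3) (id + E_{i+1} Delta_i) B_n is alternating in x_i and x_{i+1}, whence
         B_n(.., x, x, ..) + B_n(.., x-1, x-1, ..) = B_n(.., x-1, x, ..).
   By (1), the sum of M_n over the rows interlacing with k telescopes, and (3) cancels
   the terms arising from the strictness condition l_i < l_{i+1}, leaving exactly the
   sum in (2). Thus M_n obeys the row recursion of monotone triangles. *)
Require Import Defs.
From HB Require Import structures.
From mathcomp Require Import all_boot all_order all_fingroup all_algebra.
From mathcomp Require Import mpoly ring lra zify.
Set Implicit Arguments. Unset Strict Implicit. Unset Printing Implicit Defensive.
Import Order.TTheory GRing.Theory Num.Theory.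
Local Open Scope ring_scope.

(** * Translations and renamings of variables *)

Lemma comp_mpolyA (n m l : nat) (s : n.-tuple {mpoly rat[m]})
    (t : m.-tuple {mpoly rat[l]}) (f : {mpoly rat[n]}) :
  (f \mPo s) \mPo t = f \mPo [tuple (tnth s i) \mPo t | i < n].
Proof.
rewrite [RHS]comp_mpolyEX [in LHS](comp_mpolyEX f) raddf_sum /=.
apply: eq_bigr => e _; rewrite comp_mpolyZ !comp_mpolyX rmorph_prod /=.
by congr (_ *: _); apply: eq_bigr => i _; rewrite rmorphXn /= tnth_mktuple.
Qed.

Lemma eq_comp_mpoly (n m : nat) (s t : 'I_n -> {mpoly rat[m]}) f :
  s =1 t -> f \mPo [tuple s i | i < n] = f \mPo [tuple t i | i < n].
Proof.
by move=> st; congr comp_mpoly; apply: eq_from_tnth => i; rewrite !tnth_mktuple.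
Qed.

(** All operators are combinations of integer translations, whose composition adds vectors;
    commutation thus reduces to commutativity of addition. *)
Definition sh {n : nat} (v : 'I_n -> int) (f : {mpoly rat[n]}) : {mpoly rat[n]} :=
  f \mPo [tuple 'X_i + (v i)%:~R | i < n].

(** Used along [lift r], to view a polynomial in n variables as one free of x_r, and along
    transpositions. *)
Definition pullback {m n : nat} (g : 'I_m -> 'I_n) (f : {mpoly rat[m]}) :
    {mpoly rat[n]} := f \mPo [tuple 'X_(g i) | i < m].

HB.instance Definition _ n (v : 'I_n -> int) :=
  GRing.Linear.copy (sh v) (comp_mpoly [tuple 'X_i + (v i)%:~R | i < n]).
HB.instance Definition _ n (v : 'I_n -> int) :=
  GRing.RMorphism.copy (sh v) (comp_mpoly [tuple 'X_i + (v i)%:~R | i < n]).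
HB.instance Definition _ m n (g : 'I_m -> 'I_n) :=
  GRing.Linear.copy (pullback g) (comp_mpoly [tuple 'X_(g i) | i < m]).
HB.instance Definition _ m n (g : 'I_m -> 'I_n) :=
  GRing.RMorphism.copy (pullback g) (comp_mpoly [tuple 'X_(g i) | i < m]).

Definition unitv {n : nat} (q i : 'I_n) : int := (i == q)%:Z.

Definition opT {n : nat} (p q : 'I_n) (f : {mpoly rat[n]}) : {mpoly rat[n]} :=
  f + shiftE q (deltaOp p f).

Section Shifts.
Variable n : nat.
Implicit Types (u v w : 'I_n -> int) (f g : {mpoly rat[n]}).

Lemma eq_sh u v f : u =1 v -> sh u f = sh v f.
Proof. by move=> uv; apply: eq_comp_mpoly => i; rewrite uv. Qed.

Lemma shX v i : sh v 'X_i = 'X_i + (v i)%:~R.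
Proof. by rewrite /sh comp_mpolyXU -tnth_nth tnth_mktuple. Qed.

Lemma sh0 f : sh (fun=> 0) f = f.
Proof.
rewrite -[RHS]comp_mpoly_id; apply: eq_comp_mpoly => i.
by rewrite mulr0z addr0.
Qed.

Lemma sh_sh u v f : sh u (sh v f) = sh (fun i => u i + v i) f.
Proof.
rewrite {1 2}/sh comp_mpolyA; apply: eq_comp_mpoly => i.
by rewrite tnth_mktuple -/(sh u _) raddfD /= shX rmorph_int intrD addrA.
Qed.

Lemma shC u v f : sh u (sh v f) = sh v (sh u f).
Proof. by rewrite !sh_sh; apply: eq_sh => i; rewrite addrC. Qed.

Lemma meval_sh v f (x : 'I_n -> rat) :
  (sh v f).@[x] = f.@[fun i => x i + (v i)%:~R].
Proof.
rewrite comp_mpoly_meval; apply: meval_eq => i.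
by rewrite tnth_mktuple mevalD mevalXU rmorph_int.
Qed.

Lemma shiftE_sh q f : shiftE q f = sh (unitv q) f.
Proof.
by apply: eq_comp_mpoly => i; rewrite /unitv; case: eqP => _ //=; rewrite addr0.
Qed.

Lemma opTE (p q : 'I_n) f :
  opT p q f = f + sh (unitv q) (sh (unitv p) f) - sh (unitv q) f.
Proof. by rewrite /opT /deltaOp !shiftE_sh raddfB addrA. Qed.

Lemma opT_sh (p q : 'I_n) v f : opT p q (sh v f) = sh v (opT p q f).
Proof. by rewrite !opTE raddfB raddfD /= !(shC v). Qed.

Lemma opT_is_linear p q : linear (@opT n p q).
Proof.
by move=> a f g; rewrite !opTE !linearP /= -!mul_mpolyC; ring.
Qed.

End Shifts.

HB.instance Definition _ n (p q : 'I_n) :=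
  GRing.isLinear.Build rat {mpoly rat[n]} {mpoly rat[n]} _ (opT p q)
    (opT_is_linear p q).

(** * Degree bounds and inversion of the operators *)

Lemma msize_mul_le n (f g : {mpoly rat[n]}) a b :
  (msize f <= a.+1)%N -> (msize g <= b)%N -> (msize (f * g) <= a + b)%N.
Proof.
move=> fa gb; have [->|f0] := eqVneq f 0; first by rewrite mul0r msize0.
have [->|g0] := eqVneq g 0; first by rewrite mulr0 msize0.
by rewrite msizeM // -subn1 leq_subLR add1n -addSn leq_add.
Qed.

(* Subtracting the identity makes a shift degree-lowering; this is the source of
   the invertibility of [opT]. *)
Lemma msize_sh_sub_monomial n (v : 'I_n -> int) (e : 'X_{1..n}) :
  (msize (sh v 'X_[e] - 'X_[e]) <= mdeg e)%N.
Proof.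
have [d] := ubnP (mdeg e); elim: d e => // d IH e /ltnSE ed.
have [->|e0] := eqVneq e 0%MM; first by rewrite mpolyX0 rmorph1 subrr msize0.
have [i ei] : exists i, e i != 0%N.
  apply/existsP; rewrite -negb_forall; apply: contra_neqN e0 => /forallP e0.
  by apply/mnmP => i; rewrite mnm0E; apply/eqP.
have eE : e = (U_(i) + (e - U_(i)))%MM by rewrite addmC submK // lep1mP.
move: (e - U_(i))%MM eE => e' eE.
have dE : mdeg e = (mdeg e').+1 by rewrite eE mdegD mdeg1.
rewrite {1 2}eE mpolyXD rmorphM /= shX dE.
(* Discrete Leibniz rule: the induction hypothesis bounds the first summand, and the second has
   degree at most that of [e']. *)
have -> : ('X_i + (v i)%:~R) * sh v 'X_[e'] - 'X_i * 'X_[e'] =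
  ('X_i + (v i)%:~R) * (sh v 'X_[e'] - 'X_[e']) + (v i)%:~R * 'X_[e'] by ring.
have cE : (v i)%:~R = ((v i)%:~R)%:MP :> {mpoly rat[n]} by rewrite rmorph_int.
have c1 : (msize ((v i)%:~R : {mpoly rat[n]}) <= 1)%N.
  by rewrite cE msizeC; case: eqP.
apply: (leq_trans (msizeD_le _ _)); rewrite geq_max; apply/andP; split.
  rewrite -add1n; apply: msize_mul_le; last by apply: IH; rewrite -ltnS -dE.
  apply: (leq_trans (msizeD_le _ _)).
  by rewrite geq_max msizeX mdeg1 (leq_trans c1).
by rewrite -[_.+1]add0n; apply: msize_mul_le => //; rewrite msizeX.
Qed.

Lemma msize_sh_sub n (v : 'I_n -> int) f :
  (msize (sh v f - f) <= (msize f).-1)%N.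
Proof.
have -> : sh v f - f = \sum_(e <- msupp f) f@_e *: (sh v 'X_[e] - 'X_[e]).
  rewrite [in LHS](mpolyE f) raddf_sum -sumrB /=; apply: eq_bigr => e _.
  by rewrite linearZ scalerBr.
apply: (leq_trans (msize_sum _ _ _)); apply/bigmax_leqP_seq => e ef _.
apply: (leq_trans (msizeZ_le _ _)).
apply: (leq_trans (msize_sh_sub_monomial v e)).
by have := msize_mdeg_lt ef; case: (msize f).
Qed.

Lemma msize_sh n (v : 'I_n -> int) f : (msize (sh v f) <= msize f)%N.
Proof.
have -> : sh v f = (sh v f - f) + f by rewrite subrK.
apply: (leq_trans (msizeD_le _ _)); rewrite geq_max leqnn andbT.
exact: leq_trans (msize_sh_sub v f) (leq_pred _).
Qed.

Lemma msize_deltaOp n (p : 'I_n) f : (msize (deltaOp p f) <= (msize f).-1)%N.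
Proof. by rewrite /deltaOp shiftE_sh msize_sh_sub. Qed.

(** If f = - E_q Delta_p f, then the size of f is at most its own predecessor, hence zero. *)
Lemma opT_eq0 n (p q : 'I_n) f : opT p q f = 0 -> f = 0.
Proof.
move=> /eqP; rewrite /opT addr_eq0 => /eqP ff; apply/eqP.
rewrite -msize_poly_eq0; have := msize_deltaOp p f.
have := msize_sh (unitv q) (deltaOp p f).
by rewrite -shiftE_sh -(msizeN (shiftE _ _)) -ff; lia.
Qed.

Lemma msize_iter_deltaOp n (p : 'I_n) f l :
  (msize (iter l (deltaOp p) f) <= msize f - l)%N.
Proof.
elim: l => [|l IH] /=; first by rewrite subn0.
by apply: leq_trans (msize_deltaOp _ _) _; lia.
Qed.

Lemma shiftE_deltaOp n (p q : 'I_n) f :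
  deltaOp p (shiftE q f) = shiftE q (deltaOp p f).
Proof. by rewrite /deltaOp !shiftE_sh raddfB /= shC. Qed.

Lemma opT_invOp n (p q : 'I_n) f : opT p q (invOp p q f) = f.
Proof.
pose t l := (-1) ^+ l *: iter l (shiftE q) (iter l (deltaOp p) f).
(* The operator sends each term of the Neumann series to a difference of consecutive terms, so the
   sum telescopes. *)
have tE l : opT p q (t l) = t l - t l.+1.
  rewrite /t linearZ /= /opT scalerDr exprS mulN1r scaleNr opprK.
  congr (_ + _ *: shiftE q _).
  by elim: (X in iter X (shiftE q)) => //= l' <-; rewrite shiftE_deltaOp.
rewrite raddf_sum /=; under eq_bigr do rewrite tE.
rewrite -(big_mkord xpredT (fun l => t l - t l.+1)).
rewrite (telescope_sumr_eq (fun l => - t l)) // => [|l _]; last first.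
  by rewrite opprK addrC.
have -> : t (msize f).+1 = 0.
  suff d0 : iter (msize f).+1 (deltaOp p) f = 0.
    rewrite /t d0 [iter _ _ 0](_ : _ = 0) ?scaler0 //.
    by elim: (_.+1) => //= l ->; rewrite shiftE_sh raddf0.
  apply/eqP; rewrite -msize_poly_eq0 -leqn0.
  by apply: leq_trans (msize_iter_deltaOp _ _ _) _; rewrite leqn0 subn_eq0.
by rewrite oppr0 opprK add0r /t expr0 scale1r.
Qed.

(** * Products of the operators over pairs of variables *)

Lemma opT_opT n (p q p' q' : 'I_n) f :
  opT p q (opT p' q' f) = opT p' q' (opT p q f).
Proof. by rewrite (opTE p' q' f) raddfB raddfD /= !opT_sh -opTE. Qed.

(** The product of the forward operators. It is injective, so identities about [allInvOps] are
    proved by applying it to both sides. *)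
Definition foldT {n : nat} (l : seq ('I_n * 'I_n)) (f : {mpoly rat[n]}) :=
  foldr (fun pq g => opT pq.1 pq.2 g) f l.

Lemma foldT_is_linear n (l : seq ('I_n * 'I_n)) : linear (foldT l).
Proof. by move=> a f g; elim: l => //= -[p q] l ->; rewrite linearP. Qed.

HB.instance Definition _ n (l : seq ('I_n * 'I_n)) :=
  GRing.isLinear.Build rat {mpoly rat[n]} {mpoly rat[n]} _ (foldT l)
    (foldT_is_linear l).

Lemma foldT_inj n (l : seq ('I_n * 'I_n)) : injective (foldT l).
Proof.
move=> f g /eqP; rewrite -subr_eq0 -raddfB => /eqP fg.
apply/eqP; rewrite -subr_eq0; apply/eqP; move: (f - g) fg => h.
by elim: l => //= -[p q] l IH /opT_eq0.
Qed.

Lemma foldT_sh n (l : seq ('I_n * 'I_n)) v f :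
  foldT l (sh v f) = sh v (foldT l f).
Proof. by elim: l => //= -[p q] l ->; rewrite opT_sh. Qed.

Lemma foldT_opT n (l : seq ('I_n * 'I_n)) p q f :
  foldT l (opT p q f) = opT p q (foldT l f).
Proof. by elim: l => //= -[p' q'] l ->; rewrite opT_opT. Qed.

Lemma foldT_cat n (l l' : seq ('I_n * 'I_n)) f :
  foldT (l ++ l') f = foldT l (foldT l' f).
Proof. exact: foldr_cat. Qed.

Lemma foldT_perm n (l l' : seq ('I_n * 'I_n)) f :
  perm_eq l l' -> foldT l f = foldT l' f.
Proof.
elim: l l' => [|x l IH] l' ll'; first by move: ll'; rewrite perm_sym => /perm_nilP ->.
have xl' : x \in l' by rewrite -(perm_mem ll') mem_head.
case/splitPr: xl' ll' => l1 l2; rewrite perm_sym perm_catC /= perm_cons perm_sym.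
move=> ll'; rewrite foldT_cat /= foldT_opT -foldT_cat.
by congr opT; apply: IH; rewrite perm_sym perm_catC perm_sym.
Qed.

Lemma foldT_allInvOps n (f : {mpoly rat[n]}) :
  foldT (pairs_lt n) (allInvOps f) = f.
Proof.
rewrite /allInvOps; elim: (pairs_lt n) => //= -[p q] l IH.
by rewrite -foldT_opT opT_invOp.
Qed.

Lemma allInvOps_eq n (f g : {mpoly rat[n]}) :
  foldT (pairs_lt n) g = f -> allInvOps f = g.
Proof. by move=> fg; apply: (@foldT_inj _ (pairs_lt n)); rewrite foldT_allInvOps. Qed.

Lemma mem_pairs_lt n (x : 'I_n * 'I_n) : (x \in pairs_lt n) = (x.1 < x.2)%N.
Proof.
rewrite /pairs_lt mem_filter; case: (_ < _)%N => //=.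
by case: x => p q; apply/allpairsP; exists (p, q); rewrite !mem_enum.
Qed.

Lemma uniq_pairs_lt n : uniq (pairs_lt n).
Proof.
apply/filter_uniq/allpairs_uniq; rewrite ?enum_uniq //.
by move=> [p q] [p' q'].
Qed.

(** * Renaming and omitting variables *)

Section Pullback.
Variables (m n : nat) (g : 'I_m -> 'I_n).
Implicit Types (f : {mpoly rat[m]}) (v : 'I_n -> int).

Lemma pullbackX i : pullback g 'X_i = 'X_(g i).
Proof. by rewrite /pullback comp_mpolyXU -tnth_nth tnth_mktuple. Qed.

Lemma sh_pullback v f : sh v (pullback g f) = pullback g (sh (fun i => v (g i)) f).
Proof.
rewrite /sh /pullback !comp_mpolyA; apply: eq_comp_mpoly => i.
by rewrite !tnth_mktuple -/(sh v _) -/(pullback g _) raddfD /= shX pullbackX rmorph_int.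
Qed.

Lemma meval_pullback f (x : 'I_n -> rat) : (pullback g f).@[x] = f.@[fun i => x (g i)].
Proof.
rewrite comp_mpoly_meval; apply: meval_eq => i.
by rewrite tnth_mktuple mevalXU.
Qed.

Hypothesis g_inj : injective g.

(** By injectivity of [g], shifting the variable of index [g i] affects only the image of the
    variable i. *)
Lemma opT_pullback p q f : opT (g p) (g q) (pullback g f) = pullback g (opT p q f).
Proof.
have unitv_g i : (fun j => unitv (g i) (g j)) =1 unitv i.
  by move=> j; rewrite /unitv (inj_eq g_inj).
by rewrite (opTE p q) raddfB raddfD /= opTE !sh_pullback !(eq_sh _ (unitv_g _)).
Qed.

Lemma foldT_pullback l f :
  foldT [seq (g x.1, g x.2) | x <- l] (pullback g f) = pullback g (foldT l f).
Proof. by elim: l => //= -[p q] l ->; rewrite opT_pullback. Qed.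

End Pullback.

(* On polynomials free of the variable [r], the operators [opT p r] reduce to the
   shift in [p] and the operators [opT r q] to the identity. *)
Section OmitVariable.
Variables (n : nat) (r : 'I_n.+1).
Implicit Type f : {mpoly rat[n]}.

Lemma sh_unitv_omit f : sh (unitv r) (pullback (lift r) f) = pullback (lift r) f.
Proof.
rewrite sh_pullback (@eq_sh _ _ (fun=> 0)) ?sh0 // => i.
by rewrite /unitv eq_sym (negbTE (neq_lift _ _)).
Qed.

Lemma opT_omitl q f : opT r q (pullback (lift r) f) = pullback (lift r) f.
Proof. by rewrite opTE sh_unitv_omit addrK. Qed.

Lemma opT_omitr p v f :
  opT p r (sh v (pullback (lift r) f)) =
  sh (fun i => v i + unitv p i) (pullback (lift r) f).
Proof.
rewrite opT_sh opTE (shC (unitv r)) sh_unitv_omit addrAC subrr add0r.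
exact: sh_sh.
Qed.

Lemma pairs_lt_omit :
  perm_eq (pairs_lt n.+1)
    ([seq (p, r) | p : 'I_n.+1 <- enum 'I_n.+1 & (p < r)%N] ++
     [seq (r, q) | q : 'I_n.+1 <- enum 'I_n.+1 & (r < q)%N] ++
     [seq (lift r x.1, lift r x.2) | x <- pairs_lt n]).
Proof.
apply: uniq_perm => [||[p q]]; first exact: uniq_pairs_lt.
  rewrite !cat_uniq; apply/and5P; split.
  - by rewrite map_inj_uniq => [|p q []//]; exact/filter_uniq/enum_uniq.
  - apply/hasPn => x; rewrite mem_cat => /orP[] /mapP[y _ ->].
      by apply/mapP => -[z]; rewrite mem_filter => /andP[zr _] [zE yE]; rewrite -zE ltnn in zr.
    by apply/mapP => -[z _ [_ /eqP]]; rewrite eq_sym (negbTE (neq_lift _ _)).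
  - by rewrite map_inj_uniq => [|p q []//]; exact/filter_uniq/enum_uniq.
  - apply/hasPn => x /mapP[y _ ->].
    by apply/mapP => -[z _ [/eqP]]; rewrite eq_sym (negbTE (neq_lift _ _)).
  - rewrite map_inj_uniq ?uniq_pairs_lt // => -[p q] [p' q'] [].
    by move=> /(can_inj (bumpK r))/val_inj -> /(can_inj (bumpK r))/val_inj ->.
rewrite mem_pairs_lt !mem_cat; apply/idP/or3P => [/= pq|].
  case: (unliftP r p) pq => [p' ->|-> rq]; last first.
    by constructor 2; apply: map_f; rewrite mem_filter rq mem_enum.
  case: (unliftP r q) => [q' ->|-> pr]; last first.
    by constructor 1; apply: (map_f (fun p => (p, r))); rewrite mem_filter pr mem_enum.
  move=> pq; constructor 3; apply/mapP; exists (p', q') => //.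
  by rewrite mem_pairs_lt /=; move: pq; rewrite /= /bump; lia.
case=> /mapP[x].
- by rewrite mem_filter => /andP[xr _] [-> ->].
- by rewrite mem_filter => /andP[xr _] [-> ->].
- by case: x => p' q'; rewrite mem_pairs_lt => + [-> ->]; rewrite /= /bump; lia.
Qed.

(** Each pair (p, r) shifts x_p once, each pair (r, q) acts trivially, and the remaining pairs form
    the product in n variables. *)
Lemma foldT_omit f :
  foldT (pairs_lt n.+1) (pullback (lift r) f) =
  sh (fun i => (i < r)%N%:Z) (pullback (lift r) (foldT (pairs_lt n) f)).
Proof.
rewrite (foldT_perm _ pairs_lt_omit) !foldT_cat foldT_pullback; last exact: lift_inj.
set g := foldT (pairs_lt n) f.
have -> : foldT [seq (r, q) | q : 'I_n.+1 <- enum 'I_n.+1 & (r < q)%N] (pullback (lift r) g) =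
          pullback (lift r) g.
  by elim: [seq q <- _ | _] => //= q l ->; rewrite opT_omitl.
have -> (l : seq 'I_n.+1) : foldT [seq (p, r) | p <- l] (pullback (lift r) g) =
  sh (fun i => (count_mem i l)%:Z) (pullback (lift r) g).
  elim: l => [|p l IH] /=; first by rewrite sh0.
  rewrite IH opT_omitr; apply: eq_sh => i.
  by rewrite /unitv PoszD addrC eq_sym.
apply: eq_sh => i; rewrite count_uniq_mem; last exact/filter_uniq/enum_uniq.
by rewrite mem_filter mem_enum andbT.
Qed.

End OmitVariable.

(** * Determinants of rising factorials *)

(** The rising factorial X(X+1)...(X+j-1), with factors written as X - a to fit the lemmas on monic
    products. *)
Definition rising_poly {n : nat} (j : nat) : {poly {mpoly rat[n]}} :=
  \prod_(t <- iota 0 j) ('X - (- t%:R)%:P).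

Definition binom_rise {n : nat} (j : nat) (x : {mpoly rat[n]}) : {mpoly rat[n]} :=
  (rising_poly j).[x] * (j`!%:R)^-1.

Lemma rising_polyE n j (x : {mpoly rat[n]}) :
  (rising_poly j).[x] = \prod_(t < j) (x + t%:R).
Proof.
rewrite horner_prod -(big_mkord xpredT (fun t => x + t%:R)) /index_iota subn0.
by apply: eq_bigr => t _; rewrite !hornerE opprK.
Qed.

Lemma natr_unit n k : (0 < k)%N -> (k%:R : {mpoly rat[n]}) \is a GRing.unit.
Proof.
move=> k0; rewrite -(rmorph_nat (mpolyC n (R := rat))).
by apply: rmorph_unit; rewrite unitfE pnatr_eq0 -lt0n.
Qed.

Lemma fact_unit n j : (j`!%:R : {mpoly rat[n]}) \is a GRing.unit.
Proof. by rewrite natr_unit ?fact_gt0. Qed.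

Lemma binom_rise0 n (x : {mpoly rat[n]}) : binom_rise 0 x = 1.
Proof. by rewrite /binom_rise rising_polyE big_ord0 invr1 mulr1. Qed.

(** Both products contain x(x+1)...(x+j-1); the other factors differ by (x+j) - (x-1) = j+1, which
    reduces (j+1)! to j!. *)
Lemma binom_rise_sub n j (x : {mpoly rat[n]}) :
  binom_rise j.+1 x - binom_rise j.+1 (x - 1) = binom_rise j x.
Proof.
rewrite /binom_rise !rising_polyE -mulrBl big_ord_recr big_ord_recl /=.
under [X in _ - _ * X]eq_bigr => t _.
  have -> : x - 1 + (bump 0 t)%:R = x + t%:R.
    by rewrite /bump add1n -natr1; ring.
  over.
set P := \prod_(t < j) _.
have -> : P * (x + j%:R) - (x - 1 + 0%:R) * P = P * j.+1%:R by rewrite -natr1; ring.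
rewrite factS natrM invrM ?natr_unit ?fact_gt0 //.
by rewrite mulrACA mulrV ?natr_unit // mulr1.
Qed.

Lemma rmorph_binom_rise m n (h : {rmorphism {mpoly rat[m]} -> {mpoly rat[n]}}) j x :
  h (binom_rise j x) = binom_rise j (h x).
Proof.
rewrite /binom_rise !rising_polyE rmorphM rmorphV ?fact_unit // rmorph_nat rmorph_prod.
by congr (_ * _); apply: eq_bigr => t _; rewrite rmorphD rmorph_nat.
Qed.

(** The degree may depend on the row, to cover determinants in which only some variables have been
    differenced. *)
Definition rise_mx {n : nat} (c : 'I_n -> 'I_n -> nat) : 'M[{mpoly rat[n]}]_n :=
  \matrix_(i, j) binom_rise (c i j) 'X_i.

Lemma prod_sub_fact n (j : 'I_n) : (\prod_(i < n | (i < j)%N) (j - i) = j`!)%N.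
Proof.
rewrite -(big_ord_widen _ (fun i => j - i)%N) ?(ltnW (ltn_ord j)) //.
by rewrite -ffact_prod ffactnn.
Qed.

(** The change of basis from monomials to the b_j is triangular with diagonal 1/j!, and j! is the
    product of the j - i over i < j. *)
Lemma det_rise_mx n :
  \det (rise_mx (fun _ j => j : nat)) = vandermonde_normalized n.
Proof.
pose a : 'rV[{mpoly rat[n]}]_n := \row_i 'X_i.
pose C : 'M[{mpoly rat[n]}]_n :=
  \matrix_(t, j) ((rising_poly j)`_t * (j`!%:R)^-1).
have monic_rise j : @rising_poly n j \is monic.
  by rewrite /rising_poly -(big_map (fun t => - t%:R) xpredT (fun z => 'X - z%:P)) monic_prod_XsubC.
have size_rise j : size (@rising_poly n j) = j.+1.
  by rewrite /rising_poly -(big_map (fun t => - t%:R) xpredT (fun z => 'X - z%:P))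
    size_prod_XsubC size_map size_iota.
have -> : rise_mx (fun _ j => j : nat) = (Vandermonde n a)^T *m C.
  apply/matrixP => i j; rewrite !mxE /binom_rise.
  rewrite (@horner_coef_wide _ n) ?size_rise // mulr_suml.
  by apply: eq_bigr => t _; rewrite !mxE mulrAC mulrC.
rewrite det_mulmx det_tr det_Vandermonde -[\det C]det_tr det_trig; last first.
  apply/is_trig_mxP => j t jt; rewrite !mxE nth_default ?mul0r //.
  by rewrite size_rise.
have -> : \prod_i C^T i i = \prod_(i < n) \prod_(j < n | (i < j)%N) ((j - i)%N%:R)^-1.
  rewrite (exchange_big_dep xpredT) //=; apply: eq_bigr => j _.
  rewrite !mxE; have := monicP (monic_rise j); rewrite /lead_coef size_rise /= => ->.
  rewrite mul1r -prod_sub_fact natr_prod.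
  (* Inverting factor by factor requires units, so invertibility is carried along in the
     induction. *)
  suff [] : (\prod_(i < n | (i < j)%N) (j - i)%:R : {mpoly rat[n]}) \is a GRing.unit /\
    (\prod_(i < n | (i < j)%N) (j - i)%:R)^-1 =
      \prod_(i < n | (i < j)%N) ((j - i)%:R)^-1 :> {mpoly rat[n]} by [].
  apply: (big_rec2 (fun x y => x \is a GRing.unit /\ x^-1 = y)) => [|i x y ij [xu <-]].
    by rewrite unitr1 invr1.
  by rewrite unitrM invrM // ?xu natr_unit ?subn_gt0 // mulrC.
rewrite -big_split; apply: eq_bigr => i _; rewrite -big_split.
by apply: eq_bigr => j _; rewrite !mxE.
Qed.

Definition risingW (n : nat) : {mpoly rat[n]} := \det (rise_mx (fun _ (j : 'I_n) => j.+1)).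

(** Column 0 is constantly 1; deleting it raises the column indices by one, so the minors are copies
    of [risingW n]. *)
Lemma vandermonde_expand n :
  vandermonde_normalized n.+1 =
  \sum_(r < n.+1) (-1) ^+ r *: pullback (lift r) (risingW n).
Proof.
rewrite -det_rise_mx (expand_det_col _ ord0); apply: eq_bigr => r _.
rewrite mxE binom_rise0 mul1r /cofactor addn0 -signr_odd -[in RHS]signr_odd.
have -> : pullback (lift r) (risingW n) =
    \det (row' r (col' ord0 (rise_mx (fun _ (j : 'I_n.+1) => j : nat)))).
  rewrite -det_map_mx; congr (\det _); apply/matrixP => i j.
  by rewrite !mxE rmorph_binom_rise /= pullbackX.
by case: odd; rewrite ?expr0 ?expr1 ?scale1r ?mul1r // scaleN1r mulN1r.
Qed.

(** * Images of the determinants under the inverse operators *)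

(** Fact (2): translating the variables before r by -1 cancels the translation in [foldT_omit]. *)
Lemma allInvOps_vandermonde n :
  allInvOps (vandermonde_normalized n.+1) =
  \sum_(r < n.+1) (-1) ^+ r *:
    sh (fun i => - (i < r)%N%:Z) (pullback (lift r) (allInvOps (risingW n))).
Proof.
apply: allInvOps_eq; rewrite vandermonde_expand raddf_sum /=.
apply: eq_bigr => r _; rewrite linearZ /= foldT_sh foldT_omit sh_sh foldT_allInvOps.
by rewrite (@eq_sh _ _ (fun=> 0)) ?sh0 // => i; rewrite addNr.
Qed.

Definition nabla {n : nat} (t : nat) (f : {mpoly rat[n]}) :=
  f - sh (fun i => - (i == t :> nat)%:Z) f.

Lemma foldT_nabla n l ts (f : {mpoly rat[n]}) :
  foldT l (foldr nabla f ts) = foldr nabla (foldT l f) ts.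
Proof. by elim: ts => //= t ts <-; rewrite /nabla raddfB /= foldT_sh. Qed.

Lemma det_sub_row (R : comNzRingType) n (A B C : 'M[R]_n) k :
  (forall j, A k j - B k j = C k j) ->
  (forall i j, i != k -> A i j = B i j) -> (forall i j, i != k -> C i j = B i j) ->
  \det A - \det B = \det C.
Proof.
move=> ABC AB CB; rewrite (@determinant_multilinear _ _ A C B k 1 1).
- by rewrite !mul1r addrK.
- by apply/rowP => j; rewrite !mxE !mul1r -ABC subrK.
- by apply/matrixP => i j; rewrite !mxE AB ?CB // eq_sym neq_lift.
- by apply/matrixP => i j; rewrite !mxE AB // eq_sym neq_lift.
Qed.

Lemma sh_det_rise_mx n v (c : 'I_n -> 'I_n -> nat) :
  sh v (\det (rise_mx c)) = \det (\matrix_(i, j) binom_rise (c i j) ('X_i + (v i)%:~R)).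
Proof.
rewrite -[LHS]det_map_mx; congr (\det _); apply/matrixP => i j.
by rewrite mxE mxE [RHS]mxE rmorph_binom_rise /= shX.
Qed.

(** Each variable occurs in a single row, so by multilinearity its difference acts on that row alone
    and lowers b_{j+1} to b_j. *)
Lemma foldr_nabla_risingW n ts : uniq ts -> all (fun t => t < n)%N ts ->
  foldr nabla (risingW n) ts =
  \det (rise_mx (fun (i j : 'I_n) => if (i : nat) \in ts then j : nat else j.+1)).
Proof.
elim: ts => [|t ts IH] //= /andP[tts uts] /andP[tn tsn].
rewrite IH // /nabla sh_det_rise_mx.
have rowk (i : 'I_n) : i != Ordinal tn -> (i : nat) != t by rewrite -val_eqE.
apply: (@det_sub_row _ _ _ _ _ (Ordinal tn)) => [j|i j ik|i j ik].
- rewrite 3!mxE /= mem_head (negbTE tts) eqxx mulrNz.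
  exact: binom_rise_sub.
- by rewrite 2!mxE (negbTE (rowk _ ik)) oppr0 mulr0z addr0.
- by rewrite 2!mxE inE (negbTE (rowk _ ik)) oppr0 mulr0z addr0.
Qed.

Lemma foldr_nabla_allInvOps n :
  foldr nabla (allInvOps (risingW n)) (iota 0 n) = allInvOps (vandermonde_normalized n).
Proof.
apply: (@foldT_inj _ (pairs_lt n)); rewrite foldT_nabla !foldT_allInvOps.
rewrite foldr_nabla_risingW ?iota_uniq //; last by apply/allP => t; rewrite mem_iota.
rewrite -det_rise_mx; congr (\det _); apply/matrixP => i j.
by rewrite !mxE mem_iota /= add0n ltn_ord.
Qed.

Lemma pullback_tperm_risingW n (a b : 'I_n) : a != b ->
  pullback (tperm a b) (risingW n) = - risingW n.
Proof.
move=> ab; rewrite -[LHS]det_map_mx.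
have -> : map_mx (pullback (tperm a b)) (rise_mx (fun _ (j : 'I_n) => j.+1)) =
  row_perm (tperm a b) (rise_mx (fun _ (j : 'I_n) => j.+1)).
  by apply/matrixP => i j; rewrite !mxE rmorph_binom_rise /= pullbackX.
by rewrite row_permE det_mulmx det_perm odd_tperm ab mulN1r.
Qed.

(** Exchanging adjacent indices reverses the order of no pair other than (a, b). *)
Lemma perm_rem_pairs_lt n (a b : 'I_n) : b = a.+1 :> nat ->
  perm_eq [seq (tperm a b x.1, tperm a b x.2) | x <- rem (a, b) (pairs_lt n)]
    (rem (a, b) (pairs_lt n)).
Proof.
move=> ba; have mem_rem p q : ((p, q) \in rem (a, b) (pairs_lt n)) =
    (p < q)%N && ~~ ((p == a) && (q == b)).
  by rewrite mem_rem_uniq ?uniq_pairs_lt // inE mem_pairs_lt andbC xpair_eqE.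
have inj : injective (fun x : 'I_n * 'I_n => (tperm a b x.1, tperm a b x.2)).
  by move=> [p q] [p' q'] [] /perm_inj -> /perm_inj ->.
apply: uniq_perm; rewrite ?map_inj_uniq ?rem_uniq ?uniq_pairs_lt //.
move=> [p q]; rewrite -{1}[p](tpermK a b) -{1}[q](tpermK a b).
rewrite (mem_map inj _ (tperm a b p, tperm a b q)).
rewrite !mem_rem -!val_eqE /=.
by case: tpermP => [->|->|/eqP + /eqP +]; case: tpermP => [->|->|/eqP + /eqP +];
  rewrite -?val_eqE /=; lia.
Qed.

(* Up to the factor [opT a b], the operator product is symmetric in the adjacent
   variables [a] and [b], so it maps the alternating [risingW] to an alternating
   polynomial, which vanishes on the diagonal. *)
Lemma meval_opT_diag n (a b : 'I_n) (x : 'I_n -> rat) :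
  b = a.+1 :> nat -> x a = x b -> (opT a b (allInvOps (risingW n))).@[x] = 0.
Proof.
move=> ba xab; set C := opT a b _.
have ab : a != b by rewrite -val_eqE /= ba neq_ltn ltnSn.
have abp : (a, b) \in pairs_lt n by rewrite mem_pairs_lt /= ba.
set l := rem (a, b) (pairs_lt n).
have lC : foldT l C = risingW n.
  rewrite foldT_opT -[LHS]/(foldT ((a, b) :: l) _).
  by rewrite -(foldT_perm _ (perm_to_rem abp)) foldT_allInvOps.
have CN : pullback (tperm a b) C = - C.
  apply: (@foldT_inj _ l); rewrite raddfN /= lC.
  rewrite -(foldT_perm _ (perm_rem_pairs_lt ba)) foldT_pullback; last exact: perm_inj.
  by rewrite lC pullback_tperm_risingW.
have : C.@[x] = - C.@[x].
  rewrite -mevalN -CN meval_pullback; apply: meval_eq => i.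
  by case: tpermP => [->|->|].
lra.
Qed.

(** * Summation over interlacing rows *)

Definition seq_eval {n : nat} (f : {mpoly rat[n]}) (s : seq int) : rat :=
  f.@[fun i => (nth 0 s i)%:~R].

(** The backward difference of B in all variables, taken at [l]. *)
Fixpoint nabla_seq (l : seq int) (B : seq int -> rat) : rat :=
  if l is x :: t then
    nabla_seq t (fun s => B (x :: s)) - nabla_seq t (fun s => B (x - 1 :: s))
  else B [::].

(** The alternating sum of fact (2), in recursive form: entries before the omitted one are lowered
    by 1. *)
Fixpoint altsum (k : seq int) (B : seq int -> rat) : rat :=
  if k is x :: ks then B ks - altsum ks (fun s => B (x - 1 :: s)) else 0.

Lemma eq_nabla_seq l B B' : (forall s, B s = B' s) -> nabla_seq l B = nabla_seq l B'.
Proof. by elim: l B B' => //= x t IH B B' BB'; congr (_ - _); apply: IH. Qed.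

(** [altsum k] evaluates its argument only at lists one entry shorter than [k], which matches the
    fixed length in [diagonal_relation]. *)
Lemma altsumD k B1 B2 B3 :
  (forall s, (size s).+1 = size k -> B1 s + B2 s = B3 s) ->
  altsum k B1 + altsum k B2 = altsum k B3.
Proof.
elim: k B1 B2 B3 => [|x k IH] B1 B2 B3 BB /=; first by rewrite addr0.
have {}IH := IH (fun s => B1 (x - 1 :: s)) (fun s => B2 (x - 1 :: s)) (fun s => B3 (x - 1 :: s)).
by rewrite -BB // -IH => [|s sk]; [ring | rewrite BB //= sk].
Qed.

Lemma altsumE k B : altsum k B =
  \sum_(r < size k) (-1) ^+ r * B ([seq x - 1 | x <- take r k] ++ drop r.+1 k).
Proof.
elim: k B => [|x k IH] B; first by rewrite big_ord0.
rewrite /= big_ord_recl /= drop0 expr0 mul1r IH -sumrN.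
by congr (_ + _); apply: eq_bigr => r _; rewrite /= /bump add1n exprS mulN1r mulNr.
Qed.

(** The prefix [u] holds the coordinates not differenced; the induction moves the head of [l] into
    it. *)
Lemma seq_eval_nabla n (f : {mpoly rat[n]}) u l :
  seq_eval (foldr nabla f (iota (size u) (size l))) (u ++ l) =
  nabla_seq l (fun s => seq_eval f (u ++ s)).
Proof.
elim: l u => //= x l IH u; rewrite /nabla /seq_eval mevalB meval_sh.
have eqnab y : seq_eval (foldr nabla f (iota (size u).+1 (size l))) (u ++ y :: l) =
    nabla_seq l (fun s => seq_eval f (u ++ y :: s)).
  rewrite -cat_rcons -(size_rcons u y) IH; apply: eq_nabla_seq => s.
  by rewrite cat_rcons.
rewrite -eqnab -[in RHS](eqnab (x - 1)) /seq_eval; congr (_ - _); apply: meval_eq => i.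
rewrite -intrD; congr (_%:~R); rewrite !nth_cat.
case: ltngtP => iu /=; rewrite ?oppr0 ?addr0 //.
  by move: (iu); rewrite -subn_gt0; case: (i - size u)%N.
by rewrite iu subnn.
Qed.

Lemma seq_eval_vandermonde n k : size k = n.+1 ->
  seq_eval (allInvOps (vandermonde_normalized n.+1)) k =
  altsum k (seq_eval (allInvOps (risingW n))).
Proof.
move=> kn; rewrite altsumE kn allInvOps_vandermonde /seq_eval raddf_sum /=.
apply: eq_bigr => r _; rewrite mevalZ meval_sh meval_pullback.
congr (_ * _); apply: meval_eq => i; rewrite -intrD; congr (_%:~R).
have rk : (r < size k)%N by rewrite kn.
rewrite nth_cat size_map size_takel ?(ltnW rk) //= /bump.
case: (leqP r i) => ri /=.
  rewrite nth_drop add1n ltnNge leqW // oppr0 addr0.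
  by congr nth; rewrite addSn subnKC.
by rewrite add0n ri (nth_map 0) ?nth_take // size_takel ?(ltnW rk).
Qed.

Definition diagonal_relation (m : nat) (B : seq int -> rat) :=
  forall u v x, (size u + size v).+2 = m ->
    B (u ++ x :: x :: v) + B (u ++ x - 1 :: x - 1 :: v) = B (u ++ x - 1 :: x :: v).

Lemma diagonal_allInvOps n :
  diagonal_relation n (seq_eval (allInvOps (risingW n))).
Proof.
move=> u v x uvn.
have an : (size u < n)%N by lia.
have bn : ((size u).+1 < n)%N by lia.
(* Both adjacent coordinates equal x - 1, so that the shifts E_b and E_b E_a yield the other two
   values. *)
pose X (i : 'I_n) : rat := (nth 0 (u ++ x - 1 :: x - 1 :: v) i)%:~R.
have nthE y z i : nth 0 (u ++ y :: z :: v) i =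
    if (i < size u)%N then nth 0 u i else if i == size u then y
    else if i == (size u).+1 then z else nth 0 v (i - (size u).+2).
  rewrite nth_cat; case: ltngtP => // [ui|->]; last by rewrite subnn.
  rewrite -subnSK //=; case: eqP => [->|/eqP ui1]; first by rewrite subnn.
  by rewrite -subnSK // ltn_neqAle eq_sym ui1.
set B := allInvOps _.
have shb : (sh (unitv (Ordinal bn)) B).@[X] = seq_eval B (u ++ x - 1 :: x :: v).
  rewrite meval_sh; apply: meval_eq => i; rewrite /X -intrD !nthE /unitv -!val_eqE /=.
  by congr (_%:~R); case: ltngtP => iu //=; case: eqP => //= ?; lia.
have shba : (sh (unitv (Ordinal bn)) (sh (unitv (Ordinal an)) B)).@[X] =
    seq_eval B (u ++ x :: x :: v).
  rewrite !meval_sh; apply: meval_eq => i; rewrite /X -!intrD !nthE /unitv -!val_eqE /=.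
  by congr (_%:~R); case: ltngtP => iu //=; case: eqP => //= ?; lia.
have := @meval_opT_diag n (Ordinal an) (Ordinal bn) X erefl.
rewrite /X !nthE /= ltnn ltnNge leqnSn /= !eqxx gtn_eqF // => /(_ erefl).
rewrite -/X opTE mevalB mevalD -/B shba shb => /eqP.
by rewrite subr_eq0 addrC => /eqP.
Qed.

Definition irange (a b : int) : seq int :=
  if a <= b then [seq a + i%:Z | i <- iota 0 `|b - a|.+1] else [::].

Lemma mem_irange a b l : (l \in irange a b) = (a <= l <= b).
Proof.
rewrite /irange; case: lerP => ab; last by rewrite in_nil; lia.
apply/mapP/idP => [[i]|ab']; first by rewrite mem_iota => ib ->; lia.
by exists `|l - a|%N; [rewrite mem_iota|]; lia.
Qed.

Lemma uniq_irange a b : uniq (irange a b).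
Proof.
rewrite /irange; case: ifP => // _; rewrite map_inj_uniq ?iota_uniq // => i j.
by move=> /addrI [].
Qed.

(** The last term stays apart from the telescoping: at the right end of the range, strictness
    changes the bound for the next entry. *)
Lemma sum_irange a b (F G : int -> rat) : a <= b ->
  (forall l, a <= l < b -> F l = G l - G (l - 1)) ->
  \sum_(l <- irange a b) F l = G (b - 1) - G (a - 1) + F b.
Proof.
move=> ab FG; rewrite /irange ab big_map -[iota _ _]/(index_iota 0 `|b - a|.+1).
rewrite big_nat_recr //=; congr (_ + F _); last by lia.
rewrite (telescope_sumr_eq (fun i => G (a + i%:Z - 1))) // => [|i ib].
  by congr (G _ - G _); lia.
by rewrite FG; [congr (G _ - G _)|]; lia.
Qed.

(* The rows interlacing with [x :: ks]; raising the next left endpoint when [l] equals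
   it keeps a row strictly increasing. *)
Fixpoint rows (x : int) (ks : seq int) : seq (seq int) :=
  if ks is y :: ks' then
    [seq l :: t | l <- irange x y, t <- rows (if l == y then y + 1 else y) ks']
  else [:: [::]].

(** Starting the path at x - 1 allows x to equal the first entry and survives raising a left
    endpoint from y to y + 1. *)
Lemma sum_rows x ks B :
  diagonal_relation (size ks) B -> path <%R (x - 1) ks ->
  \sum_(l <- rows x ks) nabla_seq l B = altsum (x :: ks) B.
Proof.
elim: ks x B => [|y ks IH] x B dB /=; first by rewrite big_seq1 subr0.
move=> /andP[xy yks].
have dBl l : diagonal_relation (size ks) (fun s => B (l :: s)).
  by move=> u v z uv; apply: (dB (l :: u)); rewrite /= addSn uv.
have yks1 : path <%R (y - 1) ks.
  by case: ks yks {IH dB dBl} => //= z ks /andP[yz ->]; rewrite andbT; lia.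
have innerE l : \sum_(t <- rows (if l == y then y + 1 else y) ks) nabla_seq (l :: t) B =
    altsum ((if l == y then y + 1 else y) :: ks) (fun s => B (l :: s)) -
    altsum ((if l == y then y + 1 else y) :: ks) (fun s => B (l - 1 :: s)).
  by rewrite sumrB !IH //; case: eqP; rewrite ?addrK.
rewrite big_allpairs_dep; under eq_bigr do rewrite innerE.
rewrite (sum_irange (G := fun l => altsum (y :: ks) (fun s => B (l :: s)))); first last.
- by move=> l /andP[_ ly]; rewrite (lt_eqF ly).
- by lia.
rewrite eqxx /= addrK.
(* The terms left at l = y begin with (y, y), (y-1, y-1) and (y-1, y); the diagonal relation cancels
   them. *)
have dB' : altsum ks (fun s => B (y :: y :: s)) + altsum ks (fun s => B (y - 1 :: y - 1 :: s)) =
    altsum ks (fun s => B (y - 1 :: y :: s)).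
  by apply: altsumD => s sk; apply: (dB [::]); rewrite /= -sk.
rewrite -dB'; ring.
Qed.

Lemma rows_uniq x ks : uniq (rows x ks).
Proof.
elim: ks x => //= y ks IH x; apply: allpairs_uniq_dep => //; first exact: uniq_irange.
by move=> [l t] [l' t'] _ _ /= [-> ->].
Qed.

Fixpoint interlace (x : int) (ks l : seq int) : bool :=
  match ks, l with
  | [::], [::] => true
  | y :: ks', a :: t =>
      [&& x <= a <= y, interlace y ks' t & if t is b :: _ then a < b else true]
  | _, _ => false
  end.

(** Given a <= y <= b, strictness a < b fails only for a = y = b, which is what the raised endpoint
    y + 1 excludes. *)
Lemma mem_rows x ks l : (l \in rows x ks) = interlace x ks l.
Proof.
elim: ks x l => [|y ks IH] x l /=; first by rewrite inE; case: l.
apply/allpairsPdep/idP => [[a [t [aR tR ->]]]|].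
  move: aR tR; rewrite mem_irange IH => /andP[-> ay] /=; rewrite ay /=.
  case: ks t {IH} => [|z ks] [|b t] //= /and3P[/andP[yb bz] -> ->]; rewrite bz !andbT.
  by move: yb; case: eqP => [->|]; lia.
case: l => // a t /and3P[xay yt at_]; exists a, t; split => //; rewrite ?mem_irange // IH.
case: ks t {IH} yt at_ => [|z ks] [|b t] //= /and3P[/andP[yb bz] -> ->] ab.
by rewrite bz !andbT; case: eqP => [ay|]; lia.
Qed.

Lemma interlaceP x ks l : interlace x ks l <->
  size l = size ks /\
  (forall j, (j < size ks)%N -> nth 0 (x :: ks) j <= nth 0 l j <= nth 0 ks j) /\
  (forall j, (j.+1 < size ks)%N -> nth 0 l j < nth 0 l j.+1).
Proof.
elim: ks x l => [|y ks IH] x [|a t] //=; try by split=> //; case.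
split=> [/and3P[xay /IH[tk [bt lt]] at_]|[[tk] [bt lt]]].
  rewrite tk; split=> //; split=> [[|j] jk|[|j] jk] //=; first exact: bt.
    by case: t at_ tk {bt lt} => //= _ tk; rewrite -tk in jk.
  exact: lt.
apply/and3P; split; first exact: (bt 0).
  apply/IH; split=> //; split=> [j jk|j jk]; first exact: (bt j.+1).
  exact: (lt j.+1).
by case: t tk lt {bt} => // b t /= tk lt; apply: (lt 0); rewrite -tk.
Qed.

(** * Triangles as finite functions *)

Definition tri_of {n : nat} (A : nat -> nat -> int) : {ffun 'I_n * 'I_n -> int} :=
  [ffun ij : 'I_n * 'I_n => A ij.1 ij.2].

(** Extension by 0 to all natural indices, so that triangles of different sizes can be compared
    without ordinal casts. *)
Definition tri_entry {n : nat} (a : {ffun 'I_n * 'I_n -> int}) (i j : nat) : int :=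
  if insub i is Some i' then if insub j is Some j' then a (i', j') else 0 else 0.

Lemma tri_entryE n (a : {ffun 'I_n * 'I_n -> int}) (i j : 'I_n) :
  tri_entry a i j = a (i, j).
Proof. by rewrite /tri_entry !valK. Qed.

Lemma tri_of_entry n (a : {ffun 'I_n * 'I_n -> int}) : tri_of (tri_entry a) = a.
Proof. by apply/ffunP => -[i j]; rewrite ffunE tri_entryE. Qed.

Lemma tri_entry_of n A i j : (i < n)%N -> (j < n)%N ->
  tri_entry (@tri_of n A) i j = A i j.
Proof.
by move=> ilt jlt; rewrite (tri_entryE _ (Ordinal ilt) (Ordinal jlt)) ffunE.
Qed.

Lemma eq_tri_of n A A' :
  (forall i j, (i < n)%N -> (j < n)%N -> A i j = A' i j) -> @tri_of n A = tri_of A'.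
Proof. by move=> AA; apply/ffunP => -[i j]; rewrite !ffunE AA. Qed.

Definition monotone_array (n : nat) (A : nat -> nat -> int) : Prop :=
  (forall i j, (i < j)%N -> (j < n)%N -> A i j = 0) /\
  (forall i j, (i.+1 < n)%N -> (j <= i)%N -> A i.+1 j <= A i j <= A i.+1 j.+1) /\
  (forall i j, (i < n)%N -> (j < i)%N -> A i j < A i j.+1).

Lemma monotone_triangleP n (a : {ffun 'I_n * 'I_n -> int}) :
  is_monotone_triangle a <-> monotone_array n (tri_entry a).
Proof.
split=> -[a0 [ai as_]]; (split; last split).
- move=> i j ij jn.
  by have := a0 (Ordinal (ltn_trans ij jn)) (Ordinal jn) ij; rewrite -tri_entryE.
- move=> i j iln jli; have iln' := ltnW iln.
  have jln := leq_ltn_trans jli iln'; have jln' := leq_ltn_trans (jli : (j.+1 <= i.+1)%N) iln.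
  have [] := ai (Ordinal iln) (Ordinal jln) (Ordinal iln') (Ordinal jln') erefl jli erefl.
  by rewrite -!tri_entryE /= => -> ->.
- move=> i j iln jli.
  have jln := ltn_trans jli iln; have jln' := leq_ltn_trans jli iln.
  have := as_ (Ordinal iln) (Ordinal jln) (Ordinal jln') jli erefl.
  by rewrite -!tri_entryE.
- by move=> i j ij; rewrite -tri_entryE a0.
- move=> i j i' j' ii' ji' jj'; rewrite -!tri_entryE ii' jj'.
  by apply/andP; apply: ai => //; rewrite -ii'.
- by move=> i j j' j'i jj'; rewrite -!tri_entryE jj'; apply: as_ => //; rewrite -jj'.
Qed.

Definition bottom_row {n : nat} (a : {ffun 'I_n * 'I_n -> int}) (k : seq int) : Prop :=
  forall j, (j < n)%N -> tri_entry a n.-1 j = nth 0 k j.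

Lemma has_bottom_rowP n (a : {ffun 'I_n * 'I_n -> int}) (k : seq int) :
  has_bottom_row a (fun j => nth 0 k j) <-> bottom_row a k.
Proof.
split=> [ak j jn|ak i j iE].
  have n1n : (n.-1 < n)%N by case: n jn {a ak}.
  by have := ak (Ordinal n1n) (Ordinal jn) erefl; rewrite -tri_entryE.
by rewrite -tri_entryE iE ak.
Qed.

Lemma bottom_row_inj n (a : {ffun 'I_n * 'I_n -> int}) k l :
  size k = n -> size l = n -> bottom_row a k -> bottom_row a l -> k = l.
Proof.
move=> kn ln ak al; apply: (@eq_from_nth _ 0) => [|j]; rewrite kn ?ln // => jn.
by rewrite -ak // al.
Qed.

Definition add_row {n : nat} (k : seq int) (a : {ffun 'I_n * 'I_n -> int}) :
    {ffun 'I_n.+1 * 'I_n.+1 -> int} :=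
  tri_of (fun i j => if i == n then nth 0 k j else tri_entry a i j).

Lemma tri_entry_out n (a : {ffun 'I_n * 'I_n -> int}) i j : (n <= j)%N -> tri_entry a i j = 0.
Proof. by move=> nj; rewrite /tri_entry; case: insub => // ?; rewrite insubN // -leqNgt. Qed.

Lemma add_row_entry n k (a : {ffun 'I_n * 'I_n -> int}) i j : (i < n)%N -> (j <= n)%N ->
  tri_entry (add_row k a) i j = tri_entry a i j.
Proof. by move=> ilt jn; rewrite tri_entry_of ?ltnS ?(ltnW ilt) // (ltn_eqF ilt). Qed.

Lemma add_row_bottom n k (a : {ffun 'I_n * 'I_n -> int}) : bottom_row (add_row k a) k.
Proof. by move=> j jn; rewrite tri_entry_of //= eqxx. Qed.

Lemma add_row_inj n k : injective (@add_row n k).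
Proof.
move=> a b ab; rewrite -(tri_of_entry a) -(tri_of_entry b); apply: eq_tri_of => i j iln jln.
by rewrite -(add_row_entry k a iln (ltnW jln)) ab add_row_entry // ltnW.
Qed.

Lemma mem_add_row n x ks (b : {ffun 'I_n.+1 * 'I_n.+1 -> int}) : size ks = n ->
  path <%R x ks ->
  (is_monotone_triangle b /\ bottom_row b (x :: ks)) <->
  (exists2 a : {ffun 'I_n * 'I_n -> int}, b = add_row (x :: ks) a &
     is_monotone_triangle a /\ exists2 l, l \in rows x ks & bottom_row a l).
Proof.
move=> ksn pk.
have nthk j : (j < n)%N -> nth 0 (x :: ks) j < nth 0 (x :: ks) j.+1.
  by move=> jn; apply: (elimT (pathP 0) pk); rewrite ksn.
split=> [[/monotone_triangleP[b0 [bi bs]] bk]|].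
  exists (tri_of (tri_entry b)).
    rewrite -[LHS]tri_of_entry; apply: eq_tri_of => i j; rewrite !ltnS => iln jln.
    case: eqP => [->|/eqP iN]; first exact: bk.
    have {iN}iln : (i < n)%N by rewrite ltn_neqAle iN.
    (* In the last column, entries of the upper rows lie beyond the diagonal, so both sides are
       0. *)
    move: jln; rewrite leq_eqVlt => /predU1P[->|jn]; last by rewrite tri_entry_of.
    by rewrite b0 // tri_entry_out.
  split.
    apply/monotone_triangleP; split; last split.
    - move=> i j ij jn; rewrite tri_entry_of ?b0 // ?(ltn_trans ij) //.
      exact: ltnW.
    - move=> i j iln ji; rewrite !tri_entry_of ?bi //; try lia.
    - move=> i j iln ji; rewrite !tri_entry_of ?bs //; try lia.
  (* The witness is the penultimate row of [b]; for n = 0 it is the empty list. *)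
  exists [seq tri_entry b n.-1 j | j <- iota 0 n].
    rewrite mem_rows; apply/interlaceP; rewrite size_map size_iota ksn; split=> //.
    split=> j jn; rewrite ?(nth_map 0%N) ?size_iota ?nth_iota ?add0n //; try lia.
      have bkn i : (i <= n)%N -> tri_entry b n i = nth 0 (x :: ks) i := bk i.
      have n0 : (0 < n)%N := leq_ltn_trans (leq0n j) jn.
      have := bi n.-1 j; rewrite prednK // => /(_ (ltnSn n)).
      by rewrite !bkn ?(ltnW jn) // -ltnS prednK // => /(_ jn).
    by apply: bs; lia.
  move=> j jn; rewrite (nth_map 0%N) ?size_iota // nth_iota // tri_entry_of //; lia.
move=> [a -> [/monotone_triangleP[a0 [ai as_]] [l + al]]].
rewrite mem_rows => /interlaceP[ln [lb ls]].
split; last exact: add_row_bottom.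
rewrite ksn in ln lb ls.
apply/monotone_triangleP; split; last split.
- move=> i j ij jn; rewrite add_row_entry; try lia.
  have [nj|jn'] := leqP n j; first by rewrite tri_entry_out.
  by rewrite a0.
- move=> i j; rewrite !ltnS leq_eqVlt => /predU1P[iE|iln] ji; last first.
    by rewrite !add_row_entry ?ai //; lia.
  have jn : (j < n)%N by lia.
  have iE' : i = n.-1 by lia.
  rewrite iE !add_row_bottom ?ltnS ?(ltnW jn) // add_row_entry; try lia.
  by rewrite iE' al // lb.
- move=> i j; rewrite !ltnS leq_eqVlt => /predU1P[->|iln] ji.
    by rewrite !add_row_bottom ?ltnS ?nthk // ltnW.
  by rewrite !add_row_entry ?as_ //; lia.
Qed.

(** * Enumeration of triangles by their bottom row *)

Definition counts {n : nat} (P : {ffun 'I_n * 'I_n -> int} -> Prop) (c : rat) : Prop :=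
  exists s, uniq s /\ (forall a, a \in s <-> P a) /\ (size s)%:R = c.

(** A triangle determines its bottom row of length n, so enumerations for distinct rows are disjoint
    and can be concatenated. *)
Lemma counts_sum n (P : {ffun 'I_n * 'I_n -> int} -> Prop) (L : seq (seq int)) c :
  uniq L -> (forall l, l \in L -> size l = n) ->
  (forall l, l \in L -> counts (fun a => P a /\ bottom_row a l) (c l)) ->
  counts (fun a => P a /\ exists2 l, l \in L & bottom_row a l) (\sum_(l <- L) c l).
Proof.
elim: L => [|l L IH] /=.
  by move=> _ _ _; exists [::]; split=> //; rewrite big_nil; split=> // a; split=> // -[_ []].
move=> /andP[lL uL] sL cL.
have LL l' : l' \in L -> l' \in l :: L by rewrite inE orbC => ->.
have [s [us [ms ss]]] := IH uL (fun l' h => sL l' (LL l' h)) (fun l' h => cL l' (LL l' h)).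
have [t [ut [mt st]]] := cL l (mem_head l L).
exists (t ++ s); split; last split.
- rewrite cat_uniq ut us andbT; apply/hasPn => a /ms[_ [l' l'L al']].
  apply/negP => /mt[_ al]; move/negP: lL; apply.
  by rewrite (bottom_row_inj (sL _ (mem_head _ _)) (sL _ (LL _ l'L)) al al').
- move=> a; rewrite mem_cat; split.
    case/orP => [/mt[Pa al]|/ms[Pa [l' l'L al']]].
      by split=> //; exists l; rewrite ?mem_head.
    by split=> //; exists l'; rewrite // inE l'L orbT.
  case=> Pa [l']; rewrite inE => /predU1P[->|l'L] al; apply/orP.
    by left; apply/mt.
  by right; apply/ms; split=> //; exists l'.
- by rewrite size_cat natrD st ss big_cons.
Qed.

Lemma count_monotone_triangles n (k : seq int) : size k = n -> sorted <%R k ->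
  counts (fun a : {ffun 'I_n * 'I_n -> int} => is_monotone_triangle a /\ bottom_row a k)
    (seq_eval (allInvOps (vandermonde_normalized n)) k).
Proof.
elim: n k => [|n IH] k kn ks.
  exists [:: tri_of (fun _ _ => 0)]; split=> //; split=> [a|].
    split=> [_|_]; first by split; [split; [|split] | ] => -[].
    by rewrite inE; apply/eqP/ffunP => -[[]].
  have -> : allInvOps (vandermonde_normalized 0) = 1.
    rewrite /vandermonde_normalized big_ord0; apply: allInvOps_eq.
    by case: (pairs_lt 0) => // -[[]].
  by rewrite /seq_eval meval1.
case: k kn ks => // x ks [ksn] pk.
have rowsP l : l \in rows x ks -> size l = n /\ sorted <%R l.
  rewrite mem_rows => /interlaceP[ln [_ ls]]; rewrite ksn in ln ls; split=> //.
  by apply/(sortedP 0) => j; rewrite ln; apply: ls.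
have [s [us [ms ss]]] := @counts_sum n (@is_monotone_triangle n) _ _ (rows_uniq x ks)
  (fun l h => (rowsP l h).1) (fun l h => IH l (rowsP l h).1 (rowsP l h).2).
exists [seq add_row (x :: ks) a | a <- s]; split; last split.
- by rewrite map_inj_uniq //; apply: add_row_inj.
- move=> b; split=> [/mapP[a /ms sa ->]|].
    by apply/mem_add_row => //; exists a.
  by move=> /(mem_add_row _ ksn pk)[a -> /ms sa]; apply: map_f.
(* Fact (2) makes the right side an [altsum], [sum_rows] turns it into a sum over the interlacing
   rows, and fact (1) identifies the summands. *)
rewrite size_map ss seq_eval_vandermonde /= ?ksn // -/(altsum (x :: ks) _).
rewrite -sum_rows ?ksn; last first.
- by case: ks pk {ksn rowsP s us ms ss} => //= y ks /andP[xy ->]; rewrite andbT; lia.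
- exact: diagonal_allInvOps.
apply: eq_big_seq => l /rowsP[ln _].
rewrite -foldr_nabla_allInvOps.
by have := seq_eval_nabla (allInvOps (risingW n)) [::] l; rewrite ln.
Qed.

Theorem theorem2 (n : nat) (k : 'I_n -> int) :
  (0 < n)%N ->
  (forall i j : 'I_n, (i < j)%N -> k i < k j) ->
  exists s : seq {ffun 'I_n * 'I_n -> int},
    uniq s /\
    (forall a, a \in s <-> (is_monotone_triangle a /\ has_bottom_row a k)) /\
    (size s)%:R = (allInvOps (vandermonde_normalized n)).@[fun i => (k i)%:~R].
Proof.
move=> n0 kinc; pose ks := [seq k i | i <- enum 'I_n].
have sks : size ks = n by rewrite size_map size_enum_ord.
have nthk (i : 'I_n) : nth 0 ks i = k i.
  by rewrite (nth_map i) ?size_enum_ord // nth_ord_enum.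
have sorted_ks : sorted <%R ks.
  apply/(sortedP 0) => j; rewrite sks => jn.
  by have := kinc (Ordinal (ltnW jn)) (Ordinal jn) (ltnSn j); rewrite -!nthk.
have [s [us [ms ss]]] := count_monotone_triangles sks sorted_ks.
exists s; split=> //; split=> [a|].
  have kE : has_bottom_row a k <-> bottom_row a ks.
    rewrite -has_bottom_rowP; split=> ak i j iE; first by rewrite nthk ak.
    by rewrite -nthk ak.
  by rewrite kE ms.
by rewrite ss; apply: meval_eq => i; rewrite nthk.
Qed.
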